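(* Let $\overline n,\tau,\epsilon,\mu,p'(\overline n)>0$ be constants. The linearized isentropic quantum hydrodynamics system for $U=(n,v)^\top\in\mathbb{R}^4$, $v\in\mathbb{R}^3$, $x\in\mathbb{R}^3$, $$n_t+\overline n\,\nabla\cdot v=0,\qquad v_t+\frac{p'(\overline n)+\mu}{\overline n}\nabla n+\frac1\tau v=\frac{\epsilon^2}{12\,\overline n}\nabla\Delta n,$$ is genuinely coupled and symbol symmetrizable. Moreover, it is strictly dissipative of the standard type.
   Context: The system is the linearization of $\partial_tn+\nabla\cdot(nv)=0$, $\partial_t(nv)+\nabla\cdot(nv\otimes v)+\nabla p(n)-\frac{\epsilon^2}{6}n\nabla\big(\frac{\Delta\sqrt n}{\sqrt n}\big)=-\frac{nv}{\tau}-\mu\nabla n$ around a constant equilibrium state $(\overline n,0)$, $\overline n>0$; dissipativity of the nonlinear system means that of its linearization. The system has the form $U_t+\sum_{|\alpha|\le m}L^\alpha D^\alpha U=0$ with constant real matrices of size $N\times N$. For $\xi\in\mathbb{R}^d\setminus\{0\}$, $\omega=\xi/|\xi|$, put $A(\xi)=\sum_{|\alpha|\text{ odd}}|\xi|^{|\alpha|-1}(-1)^{(|\alpha|-1)/2}\omega^\alpha L^\alpha$ and $B(\xi)=\sum_{|\alpha|\text{ even}}|\xi|^{|\alpha|}(-1)^{|\alpha|/2}\omega^\alpha L^\alpha$ (so $\widehat U_t+i|\xi|A\widehat U+B\widehat U=0$). Symbol symmetrizable: there is $S\in C^\infty(\mathbb{R}^d\setminus\{0\};\mathbb{R}^{N\times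 N})$ with $S(\xi)$ symmetric positive definite, $S(\xi)A(\xi)$ and $S(\xi)B(\xi)$ symmetric and $S(\xi)B(\xi)\ge0$ for all $\xi\neq0$. Genuinely coupled: for every $\xi\ne0$, $(\mu' I_N+A(\xi))\psi\ne0$ for every $\mu'\in\mathbb{R}$ and every $\psi\in\ker B(\xi)$, $\psi\ne0$. Strictly dissipative of type $(p,q)$ ($p,q$ non-negative integers): there is $C>0$ such that for all $\xi\ne0$ every $\lambda\in\mathbb{C}$ for which $(\lambda I_N+i|\xi|A(\xi)+B(\xi))w=0$ has a nonzero solution satisfies $\mathrm{Re}\,\lambda\le-\frac{C|\xi|^{2p}}{(1+|\xi|^2)^q}$. Standard type: this holds for some $p=q$. *)

(* Defs.v *)
From HB Require Import structures.
From mathcomp Require Import all_boot all_order all_algebra.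
From mathcomp Require Import all_classical all_reals all_analysis.
From mathcomp Require Import complex.

Set Implicit Arguments.
Unset Strict Implicit.
Unset Printing Implicit Defensive.

Import Order.TTheory GRing.Theory Num.Theory.
Import numFieldNormedType.Exports.

Local Open Scope classical_set_scope.
Local Open Scope ring_scope.

Section Smoothness.
Context {R : realType} {d : nat} {W : normedModType R}.

Definition partial (i : 'I_d) (f : 'rV[R]_d -> W) : 'rV[R]_d -> W :=
  'D_(delta_mx ord0 i) f.

Definition iter_partial (s : seq 'I_d) (f : 'rV[R]_d -> W) : 'rV[R]_d -> W :=
  foldr partial f s.

(* C^infinity, for U open: the iterated partial derivatives at a point of U
   depend only on the restriction of f to U. *)
Definition smooth_on (U : set 'rV[R]_d) (f : 'rV[R]_d -> W) : Prop :=
  forall (s : seq 'I_d) (x : 'rV[R]_d), U x ->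
    {for x, continuous (iter_partial s f)} /\
    forall i : 'I_d, derivable (iter_partial s f) x (delta_mx ord0 i).

End Smoothness.

(* The norm `|xi| of the library is the sup norm on 'rV_d. *)
Definition enorm {R : realType} {d : nat} (xi : 'rV[R]_d) : R :=
  Num.sqrt (\sum_i xi ord0 i ^+ 2).

(* This box contains all multi-indices of length at most m; those of length
   larger than m are discarded by the sums below. *)
Notation multi_index d m := {ffun 'I_d -> 'I_m.+1}.

Definition mlen {d m : nat} (al : multi_index d m) : nat := (\sum_i al i)%N.

Definition mpow {R : pzSemiRingType} {d m : nat} (x : 'rV[R]_d)
    (al : multi_index d m) : R :=
  \prod_i x ord0 i ^+ al i.

(* A family L of coefficients stands for the system
     U_t + \sum_(|al| <= m) L al D^al U = 0,
   where D^al is the partial derivative of multi-index al (without factors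
   of the imaginary unit). *)
Section System.
Context {R : realType} {d m N : nat} (L : multi_index d m -> 'M[R]_N).

Definition symbA (xi : 'rV[R]_d) : 'M[R]_N :=
  let om := (enorm xi)^-1 *: xi in
  \sum_(al : multi_index d m | (mlen al <= m)%N && odd (mlen al))
    (enorm xi ^+ (mlen al).-1 * (-1) ^+ (mlen al).-1./2 * mpow om al) *: L al.

Definition symbB (xi : 'rV[R]_d) : 'M[R]_N :=
  let om := (enorm xi)^-1 *: xi in
  \sum_(al : multi_index d m | (mlen al <= m)%N && ~~ odd (mlen al))
    (enorm xi ^+ mlen al * (-1) ^+ (mlen al)./2 * mpow om al) *: L al.

Definition symmetric_mx (M : 'M[R]_N) : Prop := M^T = M.

Definition quad (M : 'M[R]_N) (x : 'cV[R]_N) : R :=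
  (x^T *m M *m x) ord0 ord0.

Definition sym_posdef (M : 'M[R]_N) : Prop :=
  symmetric_mx M /\ forall x : 'cV[R]_N, x != 0 -> 0 < quad M x.

Definition sym_possemidef (M : 'M[R]_N) : Prop :=
  symmetric_mx M /\ forall x : 'cV[R]_N, 0 <= quad M x.

Definition symbol_symmetrizable : Prop :=
  exists S : 'rV[R]_d -> 'M[R]_N,
    smooth_on [set xi | xi != 0] S /\
    forall xi : 'rV[R]_d, xi != 0 ->
      [/\ sym_posdef (S xi),
          symmetric_mx (S xi *m symbA xi) &
          sym_possemidef (S xi *m symbB xi)].

Definition genuinely_coupled : Prop :=
  forall xi : 'rV[R]_d, xi != 0 ->
  forall (mu : R) (psi : 'cV[R]_N), psi != 0 -> symbB xi *m psi = 0 ->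
    (mu%:M + symbA xi) *m psi != 0.

Definition complexify (M : 'M[R]_N) : 'M[R[i]]_N := map_mx (real_complex R) M.

Definition strictly_dissipative (p q : nat) : Prop :=
  exists2 C : R, 0 < C &
    forall xi : 'rV[R]_d, xi != 0 ->
    forall lam : R[i],
      (exists2 w : 'cV[R[i]]_N, w != 0 &
        (lam%:M + (0 +i* enorm xi)%C *: complexify (symbA xi)
           + complexify (symbB xi)) *m w = 0) ->
      complex.Re lam <= - (C * enorm xi ^+ (2 * p) / (1 + enorm xi ^+ 2) ^+ q).

Definition strictly_dissipative_standard : Prop :=
  exists p : nat, strictly_dissipative p p.

End System.

Section QHD.
Context {R : realType}.

(* Coefficients of D^al in the scalar operators Id, d/dx_j and
   (d/dx_j) Laplacian = \sum_k (d/dx_j) (d/dx_k)^2 on R^3. *)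
Definition coef_id (al : multi_index 3 3) : R :=
  [forall i, al i == 0%N :> nat]%:R.

Definition coef_d (j : 'I_3) (al : multi_index 3 3) : R :=
  [forall i, al i == (i == j) :> nat]%:R.

Definition coef_dlap (j : 'I_3) (al : multi_index 3 3) : R :=
  \sum_(k < 3) [forall i, al i == ((i == j) + 2 * (i == k))%N :> nat]%:R.

(* Linearized isentropic quantum hydrodynamics in the unknowns
   U = (n, v_1, v_2, v_3), all terms moved to the left-hand side;
   dp stands for p'(nbar). *)
Definition qhd (nbar dp tau eps mu : R) (al : multi_index 3 3) : 'M[R]_(1 + 3) :=
  block_mx
    0
    (\row_j (nbar * coef_d j al))
    (\col_j ((dp + mu) / nbar * coef_d j al
             - eps ^+ 2 / (12 * nbar) * coef_dlap j al))
    (tau^-1 * coef_id al)%:M.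

End QHD.

(* Main.v *)
(* With om = xi / |xi| and a = (dp + mu) / nbar + eps^2 / (12 nbar) |xi|^2, the
   symbols are A = [[0, nbar om], [a om^T, 0]] and B = diag(0, tau^-1). Hence
   S = diag(a / nbar, 1) is a symmetrizer; it is quadratic in xi, and quadratic
   maps are stable under partial derivatives. An eigenvalue lam is either
   -1/tau (when the density component of the eigenvector vanishes) or a root of
   lam^2 + lam / tau + nbar a |xi|^2 = 0, and nbar a >= dp + mu bounds its real
   part. *)
Require Import Defs.
From mathcomp Require Import all_boot all_order all_algebra.
From mathcomp Require Import all_classical all_reals all_analysis.
From mathcomp Require Import complex ring lra.

Import Order.TTheory GRing.Theory Num.Theory.
Import numFieldNormedType.Exports.
Set Implicit Arguments.
Unset Strict Implicit.
Unset Printing Implicit Defensive.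

Local Open Scope ring_scope.

(** * Sums over multi-indices against the coefficients of the system *)

(** The bound on [f] puts the exponent vector [f] inside the box, where exactly one multi-index [c]
    realizes it; every other term vanishes. *)
Lemma sum_eq_multi_index (R : pzRingType) (d m : nat) (P : pred nat)
    (u : nat -> R) (x : 'rV[R]_d) (f : 'I_d -> nat) :
  (forall i, f i <= m)%N ->
  \sum_(al : multi_index d m | P (mlen al))
    u (mlen al) * mpow x al * [forall i, al i == f i :> nat]%:R
  = if P (\sum_i f i)%N
    then u (\sum_i f i)%N * \prod_i x ord0 i ^+ f i else 0.
Proof.
move=> fm; pose c : multi_index d m := [ffun i => inord (f i)].
have cE i : c i = f i :> nat by rewrite ffunE inordK ?ltnS.
have eqc (al : multi_index d m) : [forall i, al i == f i :> nat] = (al == c).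
  apply/forallP/eqP => [h | -> i]; last by rewrite cE.
  by apply/ffunP => i; apply/val_inj; rewrite [RHS]cE; exact/eqP/h.
have <- : mlen c = (\sum_i f i)%N by apply: eq_bigr => i _; rewrite cE.
have <- : mpow x c = \prod_i x ord0 i ^+ f i.
  by apply: eq_bigr => i _; rewrite cE.
have [Pc|Pc] := ifPn.
  rewrite (bigD1 c) //= eqc eqxx mulr1 big1 ?addr0 // => al /andP[_ /negPf nc].
  by rewrite eqc nc mulr0.
rewrite big1 // => al Pal; rewrite eqc; case: eqP => [alc|_]; last exact: mulr0.
by rewrite -alc Pal in Pc.
Qed.

Lemma sum_delta (I : finType) (j : I) : (\sum_i (i == j) = 1)%N.
Proof. by rewrite (bigD1 j) //= eqxx big1 // => i /negPf ->. Qed.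

Lemma prod_delta (R : comPzRingType) (I : finType) (F : I -> R) (j : I) :
  \prod_i F i ^+ (i == j) = F j.
Proof. by rewrite (bigD1 j) //= eqxx big1 ?mulr1 // => i /negPf ->. Qed.

Section QHDSymbol.
Context {R : realType} (P : pred nat) (u : nat -> R) (x : 'rV[R]_3).

Lemma sum_coef_id :
  \sum_(al : multi_index 3 3 | P (mlen al)) u (mlen al) * mpow x al * coef_id al
  = if P 0%N then u 0%N else 0.
Proof.
rewrite (@sum_eq_multi_index _ 3 3 P u x (fun=> 0%N)) // big1 //.
by rewrite big1 ?mulr1.
Qed.

Lemma sum_coef_d j :
  \sum_(al : multi_index 3 3 | P (mlen al)) u (mlen al) * mpow x al * coef_d j al
  = if P 1%N then u 1%N * x ord0 j else 0.
Proof.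
rewrite (@sum_eq_multi_index _ 3 3 P u x (fun i => i == j)); last first.
  by move=> i; case: eqP.
by rewrite sum_delta prod_delta.
Qed.

Lemma sum_coef_dlap j :
  \sum_(al : multi_index 3 3 | P (mlen al)) u (mlen al) * mpow x al * coef_dlap j al
  = if P 3%N then u 3%N * (x ord0 j * \sum_k x ord0 k ^+ 2) else 0.
Proof.
under eq_bigr => al _ do rewrite mulr_sumr.
rewrite exchange_big /=.
have fm k (i : 'I_3) : ((i == j) + 2 * (i == k) <= 3)%N.
  by case: (i == j); case: (i == k).
(* Each [k] contributes the exponents of x_j x_k^2, a multi-index of length 3. *)
under eq_bigr => k _.
  rewrite (@sum_eq_multi_index _ _ _ _ _ _ _ (fm k)) big_split.
  rewrite -big_distrr /= !sum_delta.
  under eq_bigr => i _ do rewrite exprD mulnC exprM.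
  rewrite big_split /= prod_delta prodrXl prod_delta; over.
by case: ifP => _; rewrite ?big1_eq // !mulr_sumr.
Qed.

(** The parity test [P] and the weight [u] stay abstract so that one computation serves both [symbA]
    and [symbB]; only the lengths 0, 1 and 3 occur. *)
Lemma sum_qhd (nbar dp tau eps mu : R) :
  \sum_(al | P (mlen al)) (u (mlen al) * mpow x al) *: qhd nbar dp tau eps mu al
  = block_mx 0
      (nbar *: \row_j (if P 1%N then u 1%N * x ord0 j else 0))
      (\col_j ((dp + mu) / nbar * (if P 1%N then u 1%N * x ord0 j else 0)
         - eps ^+ 2 / (12 * nbar) *
           (if P 3%N then u 3%N * (x ord0 j * \sum_k x ord0 k ^+ 2) else 0)))
      (tau^-1 * (if P 0%N then u 0%N else 0))%:M.
Proof.
apply/matrixP => i j; rewrite summxE.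
case: (split_ordP i) => {}i ->; case: (split_ordP j) => {}j ->.
- rewrite block_mxEul mxE big1 // => al _.
  by rewrite mxE block_mxEul mxE mulr0.
- rewrite block_mxEur !mxE -sum_coef_d mulr_sumr.
  by apply: eq_bigr => al _; rewrite mxE block_mxEur mxE mulrCA.
- rewrite block_mxEdl !mxE -sum_coef_d -sum_coef_dlap !mulr_sumr -sumrB.
  apply: eq_bigr => al _; rewrite mxE block_mxEdl mxE mulrBr.
  by congr (_ - _); rewrite mulrCA.
- rewrite block_mxEdr !mxE -sum_coef_id mulr_sumr -sumrMnl.
  by apply: eq_bigr => al _; rewrite mxE block_mxEdr mxE mulrnAr mulrCA.
Qed.

End QHDSymbol.

(** * Euclidean norm and closed forms of the two symbols *)

Lemma enorm_sqr (R : realType) (d : nat) (x : 'rV[R]_d) :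
  enorm x ^+ 2 = \sum_i x ord0 i ^+ 2.
Proof. by rewrite sqr_sqrtr // sumr_ge0 // => i _; rewrite sqr_ge0. Qed.

Lemma enorm_gt0 (R : realType) (d : nat) (x : 'rV[R]_d) : x != 0 -> 0 < enorm x.
Proof.
move=> x0; rewrite sqrtr_gt0 lt_def sumr_ge0 ?andbT => [|i _]; last exact: sqr_ge0.
apply: contra x0 => /eqP sx; apply/eqP/rowP => i; rewrite mxE.
have /psumr_eq0P/(_ sx)/(_ i isT)/eqP : forall i, true -> 0 <= x ord0 i ^+ 2.
  by move=> k _; exact: sqr_ge0.
by rewrite sqrf_eq0 => /eqP.
Qed.

Lemma sum_sqr_direction (R : realType) (d : nat) (x : 'rV[R]_d) : x != 0 ->
  \sum_i ((enorm x)^-1 *: x) ord0 i ^+ 2 = 1.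
Proof.
move=> /enorm_gt0 x0; under eq_bigr => i _ do rewrite mxE exprMn.
by rewrite -mulr_sumr -enorm_sqr -exprMn mulVf ?expr1n // gt_eqF.
Qed.

(** The coefficient a of the density gradient in Fourier variables, with [s] standing for |xi|^2.
    The quantum term enters with a plus sign: in [symbA], length 3 carries the factor (-1)^1. *)
Definition qhd_coef {R : realType} (nbar dp eps mu : R) (s : R) : R :=
  (dp + mu) / nbar + eps ^+ 2 / (12 * nbar) * s.

Lemma symbA_qhd (R : realType) (nbar dp tau eps mu : R) (xi : 'rV[R]_3) :
  xi != 0 -> let om := (enorm xi)^-1 *: xi in
  symbA (qhd nbar dp tau eps mu) xi =
  block_mx 0 (nbar *: om) (qhd_coef nbar dp eps mu (enorm xi ^+ 2) *: om^T) 0.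
Proof.
move=> xi0 om.
rewrite /symbA (@sum_qhd R (fun k => (k <= 3)%N && odd k)
  (fun k => enorm xi ^+ k.-1 * (-1) ^+ k.-1./2)) /= sum_sqr_direction // mulr0.
congr block_mx; last by apply/matrixP => i j; rewrite !mxE mul0rn.
  by congr (_ *: _); apply/rowP => j; rewrite !mxE !mul1r.
by apply/colP => j; rewrite /qhd_coef !mxE; ring.
Qed.

Lemma symbB_qhd (R : realType) (nbar dp tau eps mu : R) (xi : 'rV[R]_3) :
  symbB (qhd nbar dp tau eps mu) xi = block_mx 0 0 0 tau^-1%:M.
Proof.
rewrite /symbB (@sum_qhd R (fun k => (k <= 3)%N && ~~ odd k)
  (fun k => enorm xi ^+ k * (-1) ^+ k./2)) /= !mulr1.
congr block_mx.
  by apply/rowP => j; rewrite !mxE mulr0.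
by apply/colP => j; rewrite !mxE !mulr0 subrr.
Qed.

(** * Definiteness of block-diagonal matrices with scalar blocks *)

Lemma quad_diag_block (R : realType) (k l : nat) (s t : R) (x : 'cV[R]_(k + l)) :
  quad (block_mx s%:M 0 0 t%:M) x =
  s * (\sum_i usubmx x i ord0 ^+ 2) + t * (\sum_i dsubmx x i ord0 ^+ 2).
Proof.
rewrite /quad -{1 2}[x]vsubmxK tr_col_mx mul_row_block !mulmx0 addr0 add0r.
rewrite mul_row_col !mul_mx_scalar -!scalemxAl !mxE.
by congr (_ * _ + _ * _); apply: eq_bigr => i _; rewrite !mxE expr2.
Qed.

Lemma sym_diag_block (R : realType) (k l : nat) (s t : R) :
  symmetric_mx (block_mx s%:M 0 0 t%:M : 'M[R]_(k + l)).
Proof. by rewrite /symmetric_mx tr_block_mx !tr_scalar_mx !trmx0. Qed.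

Lemma sum_sqr_col_gt0 (R : realType) (k : nat) (v : 'cV[R]_k) :
  v != 0 -> 0 < \sum_i v i ord0 ^+ 2.
Proof.
move=> v0; have /enorm_gt0 : v^T != 0 by rewrite trmx_eq0.
rewrite -(ltr_pXn2r (ltn0Sn 1)) ?nnegrE ?sqrtr_ge0 // expr0n enorm_sqr.
by under eq_bigr => i _ do rewrite mxE.
Qed.

Lemma diag_block_posdef (R : realType) (k l : nat) (s t : R) :
  0 < s -> 0 < t -> sym_posdef (block_mx s%:M 0 0 t%:M : 'M[R]_(k + l)).
Proof.
move=> s0 t0; split=> [|x x0]; first exact: sym_diag_block.
have sq_ge0 p (v : 'cV[R]_p) : 0 <= \sum_i v i ord0 ^+ 2.
  by apply: sumr_ge0 => i _; exact: sqr_ge0.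
rewrite quad_diag_block; have [u0|u0] := eqVneq (usubmx x) 0.
  rewrite ltr_wpDl ?mulr_ge0 ?(ltW s0) // mulr_gt0 // sum_sqr_col_gt0 //.
  apply: contra x0 => /eqP v0; rewrite -[x]vsubmxK u0 v0.
  by rewrite col_mx0.
by rewrite ltr_pwDl ?mulr_gt0 ?sum_sqr_col_gt0 // mulr_ge0 // ltW.
Qed.

Lemma diag_block_possemidef (R : realType) (k l : nat) (s t : R) :
  0 <= s -> 0 <= t -> sym_possemidef (block_mx s%:M 0 0 t%:M : 'M[R]_(k + l)).
Proof.
move=> s0 t0; split=> [|x]; first exact: sym_diag_block.
rewrite quad_diag_block addr_ge0 // mulr_ge0 // sumr_ge0 // => i _;
  exact: sqr_ge0.
Qed.

(** * Smoothness of quadratic maps *)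

Section QuadraticMap.
Local Open Scope classical_set_scope.
Local Open Scope ring_scope.
Context {R : realType} {d : nat} {W : normedModType R}.

Definition quadratic_map (c : W) (l : 'I_d -> W) (q : W) (x : 'rV[R]_d) : W :=
  c + \sum_i x ord0 i *: l i + (\sum_i x ord0 i ^+ 2) *: q.

Lemma continuous_quadratic_map c l q : continuous (quadratic_map c l q).
Proof.
move=> x; have cc i : (fun y : 'rV[R]_d => y ord0 i) @ x --> x ord0 i.
  exact: coord_continuous.
have lin : (fun y : 'rV[R]_d => \sum_i y ord0 i *: l i) @ x -->
    \sum_i x ord0 i *: l i.
  by apply: (cvg_big add_continuous (nbhs_filter x)) => i _; exact: cvgZr_tmp.
have sq : (fun y : 'rV[R]_d => \sum_i y ord0 i ^+ 2) @ x -->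
    \sum_i x ord0 i ^+ 2.
  apply: (cvg_big add_continuous (nbhs_filter x)) => i _.
  exact: (@cvgM _ _ _ _ (fun y : 'rV[R]_d => y ord0 i)).
apply: (cvgD (cvgD (cvg_cst c) lin)); exact: cvgZr_tmp.
Qed.

Lemma is_derive_quadratic_map c l q (x : 'rV[R]_d) (j : 'I_d) :
  is_derive x (delta_mx ord0 j) (quadratic_map c l q)
    (l j + (2 * x ord0 j) *: q).
Proof.
set D := l j + _.
(* The increment is computed exactly, from (x_j + h)^2 - x_j^2 = h (2 x_j + h); the difference
   quotient is then [D + h *: q] for nonzero [h]. *)
have dE h : quadratic_map c l q (h *: delta_mx ord0 j + x)
            - quadratic_map c l q x = h *: (D + h *: q).
  have coordE i : (h *: delta_mx ord0 j + x) ord0 i = h * (i == j)%:R + x ord0 i.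
    by rewrite !mxE eqxx.
  have lE : \sum_i (h *: delta_mx ord0 j + x) ord0 i *: l i
            = h *: l j + \sum_i x ord0 i *: l i.
    rewrite (bigD1 j) //= [in RHS](bigD1 j) //= coordE eqxx mulr1 scalerDl addrA.
    congr (_ + _); apply: eq_bigr => i /negPf ij.
    by rewrite coordE ij mulr0 add0r.
  have qE : \sum_i (h *: delta_mx ord0 j + x) ord0 i ^+ 2
            = h * (2 * x ord0 j + h) + \sum_i x ord0 i ^+ 2.
    rewrite (bigD1 j) //= [in RHS](bigD1 j) //= coordE eqxx mulr1 addrA.
    congr (_ + _); first by ring.
    by apply: eq_bigr => i /negPf ij; rewrite coordE ij mulr0 add0r.
  have -> : h *: (D + h *: q) = h *: l j + (h * (2 * x ord0 j + h)) *: q.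
    by rewrite /D -addrA -scalerDl scalerDr scalerA.
  rewrite /quadratic_map lE qE [(_ + \sum_i _) *: q]scalerDl.
  by rewrite [c + (_ + _)]addrCA addrACA addrK.
have cvgD' : (fun h : R => h^-1 *: ((quadratic_map c l q \o shift x)
    (h *: delta_mx ord0 j) - quadratic_map c l q x)) @ 0^' --> D.
  have : (fun h : R => D + h *: q) @ 0^' --> D.
    rewrite -[X in _ --> X]addr0 -(scale0r q).
    apply: cvg_within_filter; apply: cvgD; first exact: cvg_cst.
    exact: cvgZr_tmp.
  apply: cvg_trans; apply: near_eq_cvg; near=> h.
  rewrite /= dE scalerA mulVf ?scale1r //.
  by near: h; exact: nbhs_dnbhs_neq.
apply: DeriveDef; first by apply/cvg_ex; exists D.
exact: cvg_lim.
Unshelve. all: by end_near. Qed.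

(** The term 2 x_j q is linear in x, so it moves into the linear coefficients and the new quadratic
    coefficient is 0. *)
Lemma partial_quadratic_map c l q (j : 'I_d) :
  partial j (quadratic_map c l q) =
  quadratic_map (l j) (fun i => (2 * (i == j)%:R) *: q) 0.
Proof.
apply/funext => x; rewrite /partial.
have -> := @derive_val _ _ _ _ _ _ _ (is_derive_quadratic_map c l q x j).
rewrite /quadratic_map scaler0 addr0; congr (_ + _).
rewrite (bigD1 j) //= eqxx mulr1 big1 ?addr0 ?scalerA 1?mulrC // => i /negPf ->.
by rewrite mulr0 scale0r scaler0.
Qed.

Lemma smooth_quadratic_map (U : set 'rV[R]_d) c l q :
  smooth_on U (quadratic_map c l q).
Proof.
move=> s x _.
have [c' [l' [q' ->]]] : exists c' l' q',
    iter_partial s (quadratic_map c l q) = quadratic_map c' l' q'.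
  elim: s => [|i s [c' [l' [q' sE]]]]; first by exists c, l, q.
  by do 3 eexists; rewrite /= sE partial_quadratic_map.
split=> [|i]; first exact: continuous_quadratic_map.
exact: (@ex_derive _ _ _ _ _ _ _ (is_derive_quadratic_map _ _ _ _ _)).
Qed.

End QuadraticMap.

(** * Eigenvalues and their real parts *)

(** Write w = (n, v). If n = 0, the second row is g v = 0 with v nonzero. Otherwise, multiplying the
    second row by [om] gives c n + g (om v) = 0, and eliminating om v with the first row leaves (lam
    g - b c) n = 0. *)
Lemma rank_one_block_kernel (F : fieldType) (k : nat) (lam g b c : F)
    (om : 'rV[F]_k) (w : 'cV[F]_(1 + k)) :
  om *m om^T = 1%:M -> w != 0 ->
  block_mx lam%:M (b *: om) (c *: om^T) g%:M *m w = 0 ->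
  g = 0 \/ lam * g = b * c.
Proof.
rewrite -{1 2}[w]vsubmxK; set n := usubmx w; set v := dsubmx w => om1 w0.
rewrite mul_block_col -[X in _ = X]col_mx0 => /eq_col_mx[].
rewrite !mul_scalar_mx -!scalemxAl => nE vE.
have [n0|n0] := eqVneq n 0; [left | right].
  move: vE w0; rewrite n0 mulmx0 scaler0 add0r => /eqP.
  by rewrite scaler_eq0 => /orP[/eqP //|/eqP ->]; rewrite col_mx0 eqxx.
have omv : c *: n + g *: (om *m v) = 0.
  rewrite scalemxAr -[n]mul1mx -om1 -mulmxA scalemxAr -mulmxDr.
  by rewrite vE mulmx0.
have /eqP : (lam * g - b * c) *: n = 0.
  rewrite scalerBl mulrC -!scalerA -[lam *: n]opprK (addr0_eq nE) scalerN.
  by rewrite [g *: _]scalerA [g * b]mulrC -scalerA -(addr0_eq omv) scalerN opprK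
    subrr.
by rewrite scaler_eq0 (negPf n0) orbF subr_eq0 => /eqP.
Qed.

(** For lam = x + i y the imaginary part reads y (2 x + g) = 0. Either x = -g/2, or lam is real and
    g x = -K - x^2 <= -K. *)
Lemma damped_wave_root_le (R : realType) (g K : R) (lam : R[i]) :
  0 < g -> 0 < K -> lam * (lam + (g%:C)%C) + (K%:C)%C = 0 ->
  complex.Re lam <= - Num.min (g / 2) (K / g).
Proof.
case: lam => x y g0 K0 /eqP; rewrite eq_complex /= => /andP[/eqP re /eqP im].
rewrite lerNr ge_min.
have /eqP : y * (2 * x + g) = 0 by lra.
rewrite mulf_eq0 => /orP[/eqP y0|/eqP xE]; apply/orP; [right|left]; last by lra.
rewrite ler_pdivrMr //; move: re; rewrite y0; nra.
Qed.

(** * The three properties of the quantum hydrodynamics system *)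

Section QHD.
Context {R : realType} (nbar dp tau eps mu : R).
Context (nbar_gt0 : 0 < nbar) (tau_gt0 : 0 < tau) (dpmu_gt0 : 0 < dp + mu).
Let L := qhd nbar dp tau eps mu.
Let a := qhd_coef nbar dp eps mu.

(** The quantum term only adds a nonnegative amount; this gives a lower bound uniform in the
    frequency. *)
Lemma qhd_coef_ge (s : R) : 0 <= s -> dp + mu <= nbar * a s.
Proof.
move=> s0; have -> : nbar * a s = dp + mu + eps ^+ 2 / 12 * s.
  by rewrite /a /qhd_coef; field; rewrite gt_eqF.
by rewrite lerDl mulr_ge0 // mulr_ge0 ?sqr_ge0 // invr_ge0.
Qed.

Lemma qhd_coef_gt0 (s : R) : 0 <= s -> 0 < a s.
Proof.
move=> /qhd_coef_ge/(lt_le_trans dpmu_gt0).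
by rewrite pmulr_rgt0.
Qed.

(** The kernel of B consists of the vectors (n, 0). On them the velocity block of [m%:M + A] is a n
    om^T, nonzero because a > 0 and om is nonzero. *)
Lemma genuinely_coupled_qhd : genuinely_coupled L.
Proof.
move=> xi xi0 m psi; rewrite symbB_qhd symbA_qhd // -[psi]vsubmxK.
set n := usubmx psi; set v := dsubmx psi => psi0.
rewrite mul_block_col !mul0mx !addr0 add0r mul_scalar_mx -[X in _ = X]col_mx0.
move=> /eq_col_mx[_ /eqP].
rewrite scaler_eq0 invr_eq0 gt_eqF //= => /eqP v0; move: psi0; rewrite v0 => n0.
rewrite scalar_mx_block add_block_mx mul_block_col !mulmx0 !addr0 add0r.
apply/negP; rewrite col_mx_eq0 => /andP[_].
rewrite [n]mx11_scalar mul_mx_scalar !scaler_eq0 trmx_eq0 scaler_eq0.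
rewrite invr_eq0 (negPf xi0) (gt_eqF (enorm_gt0 xi0)).
rewrite (gt_eqF (qhd_coef_gt0 (sqr_ge0 _))) !orbF => /eqP n00; case/eqP: n0.
by rewrite [n]mx11_scalar n00 raddf0 col_mx0.
Qed.

Lemma symbol_symmetrizable_qhd : symbol_symmetrizable L.
Proof.
(* Writing |xi|^2 as a sum of squares makes the symmetrizer visibly a quadratic map; [enorm_sqr]
   later restores the norm. *)
exists (fun xi => block_mx (a (\sum_i xi ord0 i ^+ 2) / nbar)%:M 0 0 1%:M); split.
  have -> : (fun xi : 'rV[R]_3 =>
      block_mx (a (\sum_i xi ord0 i ^+ 2) / nbar)%:M 0 0 1%:M) =
    quadratic_map
      (block_mx ((dp + mu) / nbar / nbar)%:M 0 0 1%:M : 'M[R]_(1 + 3))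
      (fun=> 0) (block_mx (eps ^+ 2 / (12 * nbar) / nbar)%:M 0 0 0).
    apply/funext => xi; rewrite /quadratic_map [X in _ + X + _]big1 => [|i _];
      last by rewrite scaler0.
    rewrite addr0 scale_block_mx !scaler0 add_block_mx !addr0 scale_scalar_mx.
    by rewrite -(raddfD (@scalar_mx R 1)); congr (block_mx _%:M _ _ _);
      rewrite /a /qhd_coef; ring.
  exact: smooth_quadratic_map.
move=> xi xi0; rewrite -enorm_sqr symbA_qhd // symbB_qhd; split.
- by apply: diag_block_posdef => //; rewrite divr_gt0 // qhd_coef_gt0 // sqr_ge0.
- rewrite /symmetric_mx mulmx_block !mul0mx !mulmx0 !mul1mx !addr0 !add0r.
  rewrite tr_block_mx !trmx0 mul_scalar_mx scalerA divfK ?gt_eqF //.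
  by move: (_ *: xi) => om; rewrite !linearZ /= trmxK.
- rewrite mulmx_block !mul0mx !mulmx0 !mul1mx !addr0 !add0r.
  have tauV_ge0 : 0 <= tau^-1 by rewrite invr_ge0 ltW.
  by have := @diag_block_possemidef R 1 3 _ _ (lexx 0) tauV_ge0; rewrite raddf0.
Qed.

Lemma strictly_dissipative_qhd : strictly_dissipative L 1 1.
Proof.
(* With g = 1/tau, the first entry is the decay rate g/2 of non-real roots; the second is the factor
   of |xi|^2 in the lower bound for K/g. *)
exists (Num.min (tau^-1 / 2) (tau * (dp + mu))).
  by rewrite lt_min mulr_gt0 ?invr_gt0 //= mulr_gt0.
move=> xi xi0 lam [w w0].
set r := enorm xi; set K := r ^+ 2 * (nbar * a (r ^+ 2)).
have r0 : 0 < r by exact: enorm_gt0.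
have K0 : 0 < K by rewrite !mulr_gt0 ?exprn_gt0 // qhd_coef_gt0 ?sqr_ge0.
rewrite symbA_qhd // symbB_qhd -/r; set om := r^-1 *: xi.
(* Since [om] is real, its complexification satisfies the unit relation with the plain transpose,
   without conjugation. *)
have om1 : map_mx (real_complex R) om *m (map_mx (real_complex R) om)^T = 1%:M.
  rewrite map_trmx -map_mxM -(map_mx1 (real_complex R)); congr map_mx.
  apply/matrixP => i j; rewrite !ord1 !mxE -[RHS](sum_sqr_direction xi0).
  by apply: eq_bigr => k _; rewrite !mxE expr2.
clearbody om.
rewrite /complexify !map_block_mx scale_block_mx.
rewrite scalar_mx_block !add_block_mx !map_mxZ -!map_trmx !map_scalar_mx !map_mx0.
rewrite !scaler0 !addr0 !add0r !scalerA -(raddfD (@scalar_mx R[i] 3)).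
(* Here g is lam + 1/tau, and the product of the off-diagonal factors i|xi| nbar and i|xi| a is
   -K. *)
move=> /(rank_one_block_kernel om1 w0) lamE.
have : complex.Re lam <= - Num.min (tau^-1 / 2) (K / tau^-1).
  case: lamE => [/eqP|lamE].
    case: lam => x y; rewrite eq_complex /= => /andP[/eqP lamE _].
    have -> : x = - tau^-1 by lra.
    rewrite lerN2 ge_min; apply/orP; left.
    by rewrite ler_pdivrMr // ler_peMr ?invr_ge0 ?ltW // ltr1n.
  apply: damped_wave_root_le => //; first by rewrite invr_gt0.
  rewrite lamE; apply/eqP; rewrite eq_complex /=.
  by apply/andP; split; apply/eqP; rewrite /K /a; ring.
(* It remains to bound m r^2/(1 + r^2) by both 1/(2 tau) and K tau: the first uses r^2 <= 1 + r^2,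
   the second m r^2 <= K tau and 1 <= 1 + r^2. *)
move/le_trans; apply; rewrite lerN2 invrK muln1 expr1.
set m := Num.min (_ / 2) _.
have r20 : 0 < r ^+ 2 by rewrite exprn_gt0.
have m1 : m <= tau^-1 / 2 by rewrite ge_min lexx.
have m2 : m <= tau * (dp + mu) by rewrite ge_min lexx orbT.
have m_le : m * r ^+ 2 <= K * tau.
  apply: (le_trans (ler_wpM2r (ltW r20) m2)).
  rewrite (_ : K * tau = tau * (nbar * a (r ^+ 2)) * r ^+ 2); last first.
    by rewrite /K; ring.
  by rewrite ler_wpM2r ?(ltW r20) // ler_wpM2l ?(ltW tau_gt0) // qhd_coef_ge //
    ltW.
rewrite le_min !ler_pdivrMr ?addr_gt0 //; apply/andP; split.
  apply: le_trans (ler_wpM2r (ltW r20) m1) _.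
  by rewrite ler_wpM2l ?mulr_ge0 ?invr_ge0 ?(ltW tau_gt0) ?ler0n // lerDr ler01.
apply: (le_trans m_le); apply: ler_peMr; first by rewrite mulr_ge0 // ltW.
by rewrite lerDl ltW.
Qed.

End QHD.

Unset Implicit Arguments.

Theorem proposition5p26 (R : realType) (p : R -> R) (nbar tau eps mu : R)
    (nbar_gt0 : 0 < nbar) (tau_gt0 : 0 < tau) (eps_gt0 : 0 < eps)
    (mu_gt0 : 0 < mu) (p_derivable : derivable p nbar 1)
    (dp_gt0 : 0 < derive1 p nbar) :
  [/\ genuinely_coupled (qhd nbar (derive1 p nbar) tau eps mu),
      symbol_symmetrizable (qhd nbar (derive1 p nbar) tau eps mu) &
      strictly_dissipative_standard (qhd nbar (derive1 p nbar) tau eps mu)].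
Proof.
have dpmu_gt0 : 0 < derive1 p nbar + mu by rewrite addr_gt0.
split; first exact: genuinely_coupled_qhd.
  exact: symbol_symmetrizable_qhd.
by exists 1%N; exact: strictly_dissipative_qhd.
Qed.
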